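(* Let $R$ be a ring and $I$ an ideal of $R$ such that $R$ is a left DM ring for $I$. Then the following are equivalent: (i) $R$ is an $I$-semiregular ring; (ii) ${}_RR$ is a finitely $I$-supplemented module; (iii) $R_R$ is a finitely $I$-supplemented module.
   Context: Rings are associative with identity; modules are unital left modules unless specified otherwise; ideals are two-sided; ''summand'' means direct summand. DM: a submodule $N\leq M$ is DM in $M$ if for every submodule $X$ of $M$ with $N+X=M$ there is a summand $S$ of $M$ with $S\leq N$ and $M=S+X$. A module $M$ is DM for $I$ if every submodule of $IM$ is DM in $M$. $R$ is a left DM ring for $I$ if every finitely generated free left $R$-module is DM for $I$. Finitely $I$-supplemented: a left module $M$ is finitely $I$-supplemented if for every finitely generated submodule $X$ of $M$ there is a projective submodule $Y$ of $M$ such that $X+Y=M$, $X\cap Y\subseteq IY$ and $X\cap Y$ is DM in $Y$. For right modules the notion is the evident right-handed version, with $YI$ in place of $IY$. $I$-semiregular: an element $m$ of a module $M$ is $I$-semiregular if there is a decomposition $M=P\oplus Q$ with $P$ projective, $P\subseteq Rm$ and $Rm\cap Q\subseteq IM$. $M$ is an $I$-semiregular module if each of its elements is $I$-semiregular. The ring $R$ is $I$-semiregular if ${}_RR$ is an $I$-semiregular module (this notion is left-right symmetric). *)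

(* Defs.v *)
From HB Require Import structures.
From mathcomp Require Import all_boot all_order all_algebra.
From mathcomp Require Import boolp classical_sets functions.

Set Implicit Arguments.
Unset Strict Implicit.
Unset Printing Implicit Defensive.

Import GRing.Theory.
Local Open Scope classical_set_scope.
Local Open Scope ring_scope.

(* Rings are [pzRingType], so that the zero ring is allowed.  Left R-modules
   are [lmodType R] and right R-modules are [lmodType R^c]; in particular the
   left module R is [R^o] and the right module R is [(R^c)^o], on which r : R
   acts by x |-> x * r. *)

Section Submodules.
Context {R : pzRingType} {M : lmodType R}.

Record submodule := Submodule {
  submodule_set :> set M;
  submodule_closed : submod_closed (mem submodule_set)
}.

Definition in_submodule (N : submodule) : {pred M} := fun x => x \in (N : set M).

Lemma in_submodule_closed (N : submodule) : submod_closed (in_submodule N).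
Proof. exact: (submodule_closed N). Qed.

HB.instance Definition _ (N : submodule) :=
  GRing.isSubmodClosed.Build R M (in_submodule N) (in_submodule_closed N).

(* The elements of N, as an R-module in its own right. *)
Definition submodule_type (N : submodule) : Type := {x : M | in_submodule N x}.

HB.instance Definition _ (N : submodule) := SubChoice.on (submodule_type N).
HB.instance Definition _ (N : submodule) :=
  [SubChoice_isSubLmodule of submodule_type N by <:].

Definition add_set (A B : set M) : set M := [set x + y | x in A & y in B].

Definition direct_sum (S T Y : set M) : Prop :=
  add_set S T = Y /\ S `&` T = [set 0].

Definition cyclic_set (m : M) : set M := range (fun a : R => a *: m).

(* The set of finite sums of products a *: y with a in I and y in Y. *)
Definition ideal_mul (I : set R) (Y : set M) : set M :=
  [set x | exists n (a : 'I_n -> R) (y : 'I_n -> M),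
     [/\ forall k, I (a k), forall k, Y (y k) & x = \sum_(k < n) a k *: y k]].

Definition fg_submodule (X : submodule) : Prop :=
  exists n (e : 'I_n -> M),
    (X : set M) = range (fun c : 'I_n -> R => \sum_(k < n) c k *: e k).

(* DM relative to a submodule Y of the ambient module: the submodules of Y
   are the submodules of M contained in Y. *)
Definition summand_in (Y : set M) (S : submodule) : Prop :=
  exists T : submodule, direct_sum S T Y.

Definition DM_in (Y N : set M) : Prop :=
  forall X : submodule, X `<=` Y -> add_set N X = Y ->
  exists S : submodule,
    [/\ summand_in Y S, S `<=` N & add_set S X = Y].

End Submodules.

Arguments submodule {R} M.

Definition projective (R : pzRingType) (P : lmodType R) : Prop :=
  forall (A B : lmodType R) (f : {linear A -> B}) (g : {linear P -> B}),
    range f = setT ->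
    exists h : {linear P -> A}, forall x, f (h x) = g x.

Definition projective_submodule (R : pzRingType) (M : lmodType R)
    (Y : submodule M) : Prop :=
  projective (submodule_type Y).

Definition fg_free (R : pzRingType) (M : lmodType R) : Prop :=
  exists n (f : {linear 'rV[R]_n -> M}), bijective f.

Definition two_sided_ideal (R : pzRingType) (I : set R) : Prop :=
  submod_closed (mem I : {pred R^o}) /\ (forall x a : R, I x -> I (x * a)).

Definition DM_for (R : pzRingType) (I : set R) (M : lmodType R) : Prop :=
  forall N : submodule M, N `<=` ideal_mul I setT -> DM_in setT N.

Definition left_DM_ring (R : pzRingType) (I : set R) : Prop :=
  forall M : lmodType R, fg_free M -> DM_for I M.

Definition finitely_supplemented (R : pzRingType) (I : set R)
    (M : lmodType R) : Prop :=
  forall X : submodule M, fg_submodule X ->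
  exists Y : submodule M,
    [/\ projective_submodule Y,
        add_set X Y = setT,
        X `&` Y `<=` ideal_mul I Y
      & DM_in Y (X `&` Y)].

Definition semiregular_elt (R : pzRingType) (I : set R) (M : lmodType R)
    (m : M) : Prop :=
  exists P Q : submodule M,
    [/\ direct_sum P Q setT,
        projective_submodule P,
        P `<=` cyclic_set m
      & cyclic_set m `&` Q `<=` ideal_mul I setT].

Definition semiregular_module (R : pzRingType) (I : set R)
    (M : lmodType R) : Prop :=
  forall m : M, semiregular_elt I m.

Definition semiregular_ring (R : pzRingType) (I : set R) : Prop :=
  semiregular_module I R^o.

(* Main.v *)
(* Everything is read off idempotents.  R is I-semiregular iff every a in R has an
   idempotent e in R a with a - a e in I, a condition which passes to R^c by
   replacing e = r a, r = e r, with a r.  If R is semiregular, then for a finitely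
   generated left ideal X there is an idempotent p in X with X (1 - p) <= I, and
   Y = R (1 - p) is a supplement of X.  For Y /\ X to be DM in Y one only needs that
   the elements of I are exchange elements; this follows from the DM property of R
   alone, and it is left-right symmetric elementwise, which gives the right-handed
   case.  Conversely, let Y be a supplement of R a.  The DM property replaces Y by a
   cyclic summand R t with t = 1 modulo R a; lifting the identity of the projective
   module Y through R + S -> Y yields g with g t = t and g idempotent, and 1 - g is
   the required idempotent of R a. *)

From HB Require Import structures.
Require Import Defs.
From mathcomp Require Import all_boot all_algebra.
From mathcomp Require Import boolp classical_sets.

Set Implicit Arguments.
Unset Strict Implicit.

Import GRing.Theory.
Local Open Scope ring_scope.
Local Open Scope classical_set_scope.

(** * Elementwise conditions and their left-right symmetry *)

Lemma idem_compl (R : pzRingType) (e : R) :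
  e * e = e -> (1 - e) * (1 - e) = 1 - e.
Proof. by move=> ee; rewrite mulrBr mulr1 mulrBl mul1r ee subrr subr0. Qed.

Definition regular_mod (R : pzRingType) (I : set R) (a : R) : Prop :=
  exists e r, [/\ e * e = e, e = r * a & I (a - a * e)].

(** Suitable elements in the sense of Nicholson: exchange rings are the rings all of whose elements
    are suitable. *)
Definition exchange_elt (R : pzRingType) (a : R) : Prop :=
  exists e r s, [/\ e * e = e, r * a = e & s * (1 - a) = 1 - e].

(** Since [e * r * a = e], the element [a * (e * r)] is idempotent and its product with [a] on the
    right is [a * e], so one element of [I] serves both sides. *)
Lemma regular_mod_conv (R : pzRingType) (I : set R) (a : R) :
  regular_mod I a -> regular_mod (I : set R^c) (a : R^c).
Proof.
move=> [e [r [ee era Iae]]].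
have eera : e * r * a = e by rewrite -mulrA -era.
exists (a * (e * r)), (e * r); split => //.
- change (a * (e * r) * (a * (e * r)) = a * (e * r)).
  by rewrite -mulrA (mulrA (e * r)) eera (mulrA e e) ee.
- by change (I (a - a * (e * r) * a)); rewrite -mulrA eera.
Qed.

(* With r = e r and s = (1 - e) s, the element a + (a - a^2) (r - s) is an
   idempotent of a R whose complement lies in (1 - a) R. *)
Lemma exchange_elt_conv (R : pzRingType) (a : R) :
  exchange_elt a -> exchange_elt (a : R^c).
Proof.
move=> [e [r0 [s0 [ee era esa]]]].
pose r := e * r0; pose s := (1 - e) * s0.
have er : e * r = r by rewrite mulrA ee.
have es : e * s = 0 by rewrite mulrA mulrBr mulr1 ee subrr mul0r.
have ra : r * a = e by rewrite -mulrA era.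
have sa : s * (1 - a) = 1 - e by rewrite -mulrA esa idem_compl.
clearbody r s; clear r0 s0 era esa.
pose t := r - s; pose d := a * (1 - a).
have dE : d = (1 - a) * a by rewrite /d mulrBl mulrBr mul1r mulr1.
have da : d * a = a * d by rewrite {1}/d -mulrA -dE.
have dE1 : d = a * (1 - a) by [].
clearbody d.
have ta : t * a = 1 - s.
  have -> : t * a = e - s * a by rewrite mulrBl ra.
  have -> : s * a = s - (1 - e) by rewrite -sa mulrBr mulr1 subKr.
  by rewrite opprB addrA subrKC.
have td : t * d = e - a.
  by rewrite dE1 mulrA ta mulrBl mul1r sa opprB addrCA addrAC subrr add0r.
have et : e * t = r by rewrite mulrBr er es subr0.
pose f := a + d * t.
have fE : f = a + d * t by [].
have tf : t * f = 1 + t - a * t.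
  by rewrite fE mulrDr ta mulrA td mulrBl et addrA -[1 - s + r]addrA [- s + r]addrC.
clearbody t f.
exists f, (1 + (1 - a) * t), (1 - a * t); split.
(* As [d] commutes with [a], the terms [a * d * t] and [d * a * t] cancel, leaving
   [a * a + d + d * t], where [a * a + d = a]. *)
- change (f * f = f); rewrite {1}fE mulrDl -mulrA tf fE !mulrDr mulrN mulr1 !mulrA da.
  rewrite addrACA subrr addr0.
  by rewrite addrA dE1 mulrBr mulr1 subrKC.
- by change (a * (1 + (1 - a) * t) = f); rewrite fE dE1 mulrDr mulr1 mulrA.
- by change ((1 - a) * (1 - a * t) = 1 - f); rewrite fE mulrBr mulr1 mulrA -dE opprD addrA.
Qed.

(** * Closure properties of submodules and ideals *)

Lemma mem_submodule (R : pzRingType) (M : lmodType R) (N : submodule M) (x : M) :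
  (N : set M) x -> x \in in_submodule N.
Proof. by move=> Nx; rewrite unfold_in inE. Qed.

Lemma submodule_mem (R : pzRingType) (M : lmodType R) (N : submodule M) (x : M) :
  x \in in_submodule N -> (N : set M) x.
Proof. by rewrite unfold_in inE. Qed.

Lemma submodule0 (R : pzRingType) (M : lmodType R) (N : submodule M) : (N : set M) 0.
Proof. exact/submodule_mem/rpred0. Qed.

Lemma submodule_sub (R : pzRingType) (M : lmodType R) (N : submodule M) (x y : M) :
  (N : set M) x -> (N : set M) y -> (N : set M) (x - y).
Proof.
by move=> Nx Ny; apply: submodule_mem; apply: rpredB; apply: mem_submodule.
Qed.

Lemma submodule_add (R : pzRingType) (M : lmodType R) (N : submodule M) (x y : M) :
  (N : set M) x -> (N : set M) y -> (N : set M) (x + y).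
Proof.
by move=> Nx Ny; apply: submodule_mem; apply: rpredD; apply: mem_submodule.
Qed.

Lemma submodule_scale (R : pzRingType) (M : lmodType R) (N : submodule M) (a : R)
    (x : M) :
  (N : set M) x -> (N : set M) (a *: x).
Proof. by move=> Nx; apply: submodule_mem; apply: rpredZ; apply: mem_submodule. Qed.

Lemma submodule_mulr (R : pzRingType) (N : submodule R^o) (a x : R) :
  (N : set R^o) x -> (N : set R^o) (a * x).
Proof. exact: submodule_scale. Qed.

Definition submodule_elt (R : pzRingType) (M : lmodType R) (N : submodule M)
  (x : M) (Nx : (N : set M) x) : submodule_type N := exist _ x (mem_submodule Nx).

Section Ideals.
Variables (R : pzRingType) (I : set R).
Hypothesis idealI : two_sided_ideal I.

Lemma ideal0 : I 0.
Proof. by have [[I0 _] _] := idealI; rewrite inE in I0. Qed.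

Lemma ideal_lin a x y : I x -> I y -> I (a * x + y).
Proof.
move=> Ix Iy; have [[_ /(_ a x y) lin] _] := idealI.
by move: lin; rewrite !inE; apply.
Qed.

Lemma idealD x y : I x -> I y -> I (x + y).
Proof. by move=> Ix Iy; rewrite -[x]mul1r; apply: ideal_lin. Qed.

Lemma idealMl a x : I x -> I (a * x).
Proof. by move=> Ix; rewrite -[_ * x]addr0; apply: ideal_lin ideal0. Qed.

Lemma idealMr a x : I x -> I (x * a).
Proof. exact: (proj2 idealI). Qed.

Lemma ideal_sum n (F : 'I_n -> R) : (forall k, I (F k)) -> I (\sum_k F k).
Proof.
by move=> IF; apply: (big_ind I ideal0 idealD) => k _; apply: IF.
Qed.

Lemma ideal_mul_sub (Y : set R^o) : ideal_mul I Y `<=` I.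
Proof.
move=> _ [n [a [y [Ia _ ->]]]]; apply: ideal_sum => k.
exact/idealMr/Ia.
Qed.

Lemma sub_ideal_mul (M : lmodType R) (Y : set M) a y :
  I a -> Y y -> ideal_mul I Y (a *: y).
Proof.
move=> Ia Yy; exists 1%N, (fun=> a), (fun=> y); split=> //.
by rewrite big_ord1.
Qed.

Lemma two_sided_ideal_conv : two_sided_ideal (I : set R^c).
Proof.
split; last by move=> x a; apply: idealMl.
split; first by rewrite inE; exact: ideal0.
by move=> a x y; rewrite !inE => Ix; apply: idealD; apply: idealMr.
Qed.
End Ideals.

(** * Idempotents, cyclic submodules and projectivity *)

Section Cyclic.
Variables (R : pzRingType).

Lemma cyclic_set_closed (M : lmodType R) (m : M) :
  submod_closed (mem (cyclic_set m)).
Proof.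
split; first by rewrite inE; exists 0 => //; rewrite scale0r.
move=> a x y; rewrite !inE => -[b _ <-] [c _ <-].
by exists (a * b + c) => //; rewrite scalerDl scalerA.
Qed.

Definition cyclic_submodule (M : lmodType R) (m : M) : submodule M :=
  Submodule (cyclic_set_closed m).

Lemma cyclic_idemP (e x : R) : e * e = e -> cyclic_set (e : R^o) x <-> x * e = x.
Proof.
move=> ee; split=> [[a _ <-]|xe]; last by exists x.
by rewrite -[LHS]mulrA ee.
Qed.

(** A preimage [a] of [g e] gives the lift sending [x] to [x *: a], because [x = x * e] on [R e]. *)
Lemma projective_cyclic_idem (e : R) :
  e * e = e -> projective_submodule (cyclic_submodule (e : R^o)).
Proof.
move=> ee A B f g fA.
pose Y := cyclic_submodule (e : R^o).
have Ye : (Y : set R^o) e by apply/cyclic_idemP.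
pose e' := submodule_elt Ye.
have [a _ fa] : range f (g e') by rewrite fA.
pose h (x : submodule_type Y) : A := (val x : R) *: a.
have hlin : linear h by move=> c x y; rewrite /h scalerDl scalerA.
pose hL : {linear submodule_type Y -> A} :=
  HB.pack h (GRing.isLinear.Build _ _ _ _ h hlin).
exists hL => x; rewrite /= /h linearZ /= fa -linearZ /=; congr (g _).
apply: val_inj => /=.
by have /submodule_mem/cyclic_idemP := valP x; apply.
Qed.
End Cyclic.

(* Extensionality with x : R rather than x : R^o, so that products of elements
   of the regular module are taken in R. *)
Lemma eq_regular_set (R : pzRingType) (A B : set R^o) :
  (forall x : R, A x <-> B x) -> A = B.
Proof. by rewrite predeqE. Qed.

(** Take for [e] the component of 1 in [S]: for [x] in [S], [x - x * e = x * (1 - e)] lies in both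
    [S] and [T]. *)
Lemma direct_sum_regular_idem (R : pzRingType) (S T : submodule R^o) :
  direct_sum S T setT ->
  exists e : R, [/\ (S : set R^o) e, (T : set R^o) (1 - e) &
                    forall x : R, (S : set R^o) x -> x * e = x].
Proof.
move=> [STT ST0].
have [e Se [t Tt et]] : add_set S T (1 : R^o) by rewrite STT.
have tE : t = 1 - e :> R by rewrite -et [e + t]addrC addrK.
exists e; split=> [||x Sx] //; first by rewrite -tE.
have : (S `&` T) (x - x * e : R^o).
  split; first by apply: submodule_sub => //; exact: (submodule_mulr x Se).
  rewrite -[X in X - _]mulr1 -mulrBr -tE; exact: (submodule_mulr x Tt).
by rewrite ST0 => /subr0_eq.
Qed.

(* Lift the identity of Y through R x S -> Y, (c, s) |-> c t + s. *)
Lemma projective_cyclic_split (R : pzRingType) (M : lmodType R)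
    (Y S : submodule M) (t : M) (Yt : (Y : set M) t) :
  projective_submodule Y -> direct_sum S (cyclic_submodule t) Y ->
  exists h : {linear submodule_type Y -> R^o}, (h (submodule_elt Yt) : R) *: t = t.
Proof.
move=> projY [SY S0].
have YS s : (S : set M) s -> (Y : set M) s.
  move=> Ss; rewrite -SY; exists s => //; exists 0; last by rewrite addr0.
  by exists 0 => //; rewrite scale0r.
pose F (p : R^o * submodule_type S) : M := (p.1 : R) *: t + val p.2.
have FY p : (Y : set M) (F p).
  by apply: submodule_add; [exact: submodule_scale | exact/YS/submodule_mem/(valP p.2)].
pose f p : submodule_type Y := submodule_elt (FY p).
have flin : linear f.
  move=> c p q; apply: val_inj; rewrite /= /F /=.
  by rewrite scalerDl scalerDr scalerA addrACA.
pose fL : {linear (R^o * submodule_type S)%type -> submodule_type Y} :=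
  HB.pack f (GRing.isLinear.Build _ _ _ _ f flin).
have f_surj : range fL = setT.
  rewrite predeqE => x; split=> // _.
  have /submodule_mem := valP x; rewrite -{1}SY => -[s Ss [_ [c _ <-] sE]].
  by exists (c : R^o, submodule_elt Ss) => //; apply: val_inj; rewrite /= /F /= addrC.
have [h hK] := projY _ _ fL idfun f_surj.
exists (fst \o h) => /=.
have /(congr1 val) /= := hK (submodule_elt Yt); rewrite /F /=.
set g := (h _).1 => hE.
(* By [hE] the difference is the [S]-component of the lift of [t]. *)
have : (S `&` cyclic_submodule t) (t - (g : R) *: t).
  split; first by rewrite -[X in X - _]hE addrC addKr; exact/submodule_mem/(valP _.2).
  by exists (1 - g) => //; rewrite scalerBl scale1r.
by rewrite S0 => /subr0_eq.
Qed.

(** * From module conditions to elementwise ones and back *)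

Section Equivalences.
Variables (R : pzRingType) (I : set R).
Hypothesis idealI : two_sided_ideal I.

Lemma semiregular_eltP (a : R) : semiregular_elt I (a : R^o) <-> regular_mod I a.
Proof.
split=> [[P [Q [PQ _ Pa aQ]]]|[e [r [ee era Iae]]]].
  have [e [Pe Qe idP]] := direct_sum_regular_idem PQ.
  have [r _ er'] := Pa e Pe; have era : r * a = e := er'.
  exists e, r; split=> //; first exact: idP.
  apply: (ideal_mul_sub idealI (Y := setT)); apply: aQ.
  (* The element is a multiple of [1 - e], hence in [Q], and equals [(1 - a * r) * a], hence is in
     [R a]. *)
  have -> : a - a * e = a * (1 - e) by rewrite mulrBr mulr1.
  split; last exact: (submodule_mulr a Qe).
  exists (1 - a * r) => //; change ((1 - a * r) * a = a * (1 - e)).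
  by rewrite mulrBl mul1r mulrBr mulr1 -mulrA era.
have ff := idem_compl ee.
exists (cyclic_submodule (e : R^o)), (cyclic_submodule (1 - e : R^o)); split.
- split.
    apply: eq_regular_set => x; split=> // _.
    exists (x * e); first by exists x.
    exists (x * (1 - e)); first by exists x.
    by rewrite mulrBr mulr1 subrKC.
  apply: eq_regular_set => x; split=> [[/cyclic_idemP xe /cyclic_idemP xf]|->].
    have {}xf := xf ff; rewrite mulrBr mulr1 xe // subrr in xf.
    by rewrite /= xf.
  by split; apply/cyclic_idemP; rewrite ?mul0r.
- exact: projective_cyclic_idem.
- by move=> _ [x _ <-]; exists (x * r) => //; rewrite /= era scalerA.
- move=> _ [[x _ <-] /cyclic_idemP xf].
  rewrite -[X in ideal_mul _ _ X](xf ff) -[X in ideal_mul _ _ X]mulr1.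
  apply: sub_ideal_mul => //.
  change (I (x * a * (1 - e))); rewrite -mulrA mulrBr mulr1.
  exact: idealMl.
Qed.

Lemma supplemented_regular_mod (a : R) :
  finitely_supplemented I R^o -> regular_mod I a.
Proof.
move=> suppR.
have aX : fg_submodule (cyclic_submodule (a : R^o)).
  exists 1%N, (fun=> a); apply: eq_regular_set => x; split=> [[c _ <-]|[c _ <-]].
    by exists (fun=> c) => //; rewrite big_ord1.
  by exists (c ord0) => //; rewrite big_ord1.
have [Y [projY aY IY DMY]] := suppR _ aX.
have [r [y [Yy rayE]]] : exists r y : R, (Y : set R^o) y /\ r * a + y = 1.
  have [_ [r _ <-] [y Yy ray]] : add_set (cyclic_submodule (a : R^o)) Y 1 by rewrite aY.
  by exists r, y.
have yY : cyclic_submodule (y : R^o) `<=` Y by move=> _ [c _ <-]; exact: submodule_scale.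
have xryE (x : R) : x * r * a = x - x * y by rewrite -mulrA -{2}[x]mulr1 -mulrBr -rayE addrK.
(* For [x] in [Y], [x - x * y = x * r * a] lies in [R a] and in [Y]. *)
have NyY : add_set (cyclic_submodule (a : R^o) `&` Y) (cyclic_submodule (y : R^o)) = Y.
  apply: eq_regular_set => x; split=> [[u [_ Yu] [v /yY Yv <-]]|Yx].
    exact: submodule_add.
  exists (x - x *: (y : R^o)); last by exists (x *: (y : R^o)); [exists x | rewrite subrK].
  split; first by exists (x * r) => //; exact: xryE.
  by apply: submodule_sub => //; exact: submodule_scale.
have [S [[T [STY ST0]] Sa SyY]] := DMY _ yY NyY.
(* The [T]-component [t] replaces [y]: [R t] meets [S] in 0, and [t] is still 1 modulo [R a] because
   [s0] lies in [R a]. *)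
have [s0 Ss0 [t Tt ys0t]] : add_set S T y by rewrite STY.
have YS (s : R^o) : (S : set R^o) s -> (Y : set R^o) s by move=> /Sa[].
have Yt : (Y : set R^o) t.
  by rewrite -(addKr s0 t) ys0t addrC; apply: submodule_sub => //; exact: YS.
have [r' ta] : exists r' : R, t = 1 - r' * a.
  have [[c _ cE] _] := Sa _ Ss0.
  exists (r + c); have <- : s0 + t - s0 = t by rewrite addrC addKr.
  rewrite ys0t -cE -(addKr (r * a) y) rayE mulrDl opprD.
  by rewrite [- (r * a) + 1]addrC addrA.
have St : direct_sum S (cyclic_submodule t) Y.
  split.
    apply: eq_regular_set => x; split=> [[u Su [_ [c _ <-] <-]]|].
      by apply: submodule_add; [exact: YS | exact: submodule_scale].
    rewrite -{1}SyY => -[s Ss [_ [c _ <-] <-]].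
    exists (s + c *: s0); first by apply: submodule_add => //; exact: submodule_scale.
    exists (c *: t); first by exists c.
    by rewrite -ys0t scalerDr addrA.
  rewrite -ST0 predeqE => x; split=> [[Sx [c _ cx]]|].
    by split=> //; rewrite -cx; exact: submodule_scale.
  rewrite ST0 => ->; split; first exact: submodule0.
  by exists 0; rewrite ?scale0r.
have [h] := projective_cyclic_split Yt projY St.
set t' := submodule_elt Yt; set g : R := h t' => gtZ.
have gt : g * t = t := gtZ.
have gM (x : R) (Yx : (Y : set R^o) (x * t)) : h (submodule_elt Yx) = x * g :> R.
  rewrite (_ : submodule_elt Yx = x *: t') ?linearZ //.
  exact: val_inj.
have gg : g * g = g.
  have Ygt : (Y : set R^o) (g * t) by exact: submodule_mulr.
  by rewrite -(gM _ Ygt) /g; congr (h _); exact: val_inj.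
(* This puts [a * g = h (a * t)] in [I], since [a * t] lies in [R a] and in [Y]. *)
have hI x (Yx : (Y : set R^o) x) : ideal_mul I Y x -> I (h (submodule_elt Yx)).
  move=> [n [c [z [Ic Yz xE]]]].
  have -> : submodule_elt Yx = \sum_k c k *: submodule_elt (Yz k).
    by apply: val_inj; rewrite raddf_sum; exact: xE.
  rewrite linear_sum; apply: (ideal_sum idealI) => k.
  by rewrite linearZ; exact: idealMr.
have tE (x : R) : x * t = x - x * r' * a by rewrite ta mulrBr mulr1 mulrA.
(* As [r' * a = 1 - t] and [g * t = t], [(1 - g) * r' * a = 1 - g]. *)
exists (1 - g), ((1 - g) * r'); split.
- exact: idem_compl.
- apply/esym/subr0_eq/oppr_inj; rewrite opprB -tE oppr0.
  by rewrite mulrBl mul1r gt subrr.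
- rewrite mulrBr mulr1 subKr.
  have Yat : (Y : set R^o) (a * t) by exact: submodule_mulr.
  rewrite -(gM _ Yat); apply/hI/IY; split=> //.
  by exists (1 - a * r') => //; change ((1 - a * r') * a = a * t); rewrite mulrBl mul1r tE.
Qed.

(** The DM property for [R a + R (1 - a) = R] gives a summand [R e] in [R a] with
    [1 = c * e + d * (1 - a)]. Correcting [e] by [u = (1 - e) * c * e] turns its complement into [(1
    - e) * (1 - c * e) = (1 - e) * d * (1 - a)]. *)
Lemma DM_exchange_elt (a : R) : DM_for I R^o -> I a -> exchange_elt a.
Proof.
move=> DMR Ia.
have aI : cyclic_submodule (a : R^o) `<=` ideal_mul I setT.
  by move=> _ [c _ <-]; rewrite -[c *: _]mulr1; apply: sub_ideal_mul => //; exact: idealMl.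
have [//||S [[T ST] Sa SX]] := DMR _ aI (cyclic_submodule (1 - a : R^o)).
  apply: eq_regular_set => x; split=> // _.
  exists (x * a); first by exists x.
  exists (x * (1 - a)); first by exists x.
  by rewrite mulrBr mulr1 subrKC.
have [e [Se _ idS]] := direct_sum_regular_idem ST.
have ee := idS _ Se.
have [r _ ra] := Sa _ Se; have {}ra : r * a = e := ra.
have [c Sc [_ [d _ <-] cd]] : add_set S (cyclic_submodule (1 - a : R^o)) 1.
  by rewrite SX.
have {}cd : c * e + d * (1 - a) = 1 :> R by rewrite (idS _ Sc).
pose u := (1 - e) * c * e.
have eu : e * u = 0 by rewrite !mulrA mulrBr mulr1 ee subrr !mul0r.
have ue : u * e = u by rewrite -mulrA ee.
have uu : u * u = 0 by rewrite -[in X in X * _]ue -mulrA eu mulr0.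
exists (e + u), ((1 + (1 - e) * c) * r), ((1 - e) * d); split.
- by rewrite mulrDl !mulrDr ee eu uu ue !addr0.
- by rewrite -mulrA ra mulrDl mul1r.
- have -> : (1 - e) * d * (1 - a) = (1 - e) * (1 - c * e).
    by rewrite -mulrA -[d * _](addKr (c * e)) cd [- _ + 1]addrC.
  by rewrite mulrBr mulr1 mulrA opprD addrA.
Qed.

(** Induction: [p] serves all generators but the first, and [f] serves [e ord0 * (1 - p)]. As
    [f * p = 0], [(1 - p) * f] is an idempotent orthogonal to [p], and the sum has complement
    [(1 - p) * (1 - f)]. *)
Lemma regular_mod_range n (e : 'I_n -> R) :
  (forall a, regular_mod I a) ->
  exists p : R, [/\ p * p = p, exists c : 'I_n -> R, p = \sum_k c k * e k &
                    forall k, I (e k - e k * p)].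
Proof.
move=> regR; elim: n e => [|n IHn] e.
  exists 0; split; [by rewrite mulr0 | by exists (fun=> 0); rewrite big_ord0 | by case].
have [p [pp [c pE] Ip]] := IHn (fun k => e (lift ord0 k)).
have p0 : (1 - p) * p = 0 by rewrite mulrBl mul1r pp subrr.
have [f [r [ff frE If]]] := regR (e ord0 * (1 - p)).
have fp : f * p = 0 by rewrite frE -!mulrA p0 !mulr0.
have fp1 : f * (1 - p) = f by rewrite mulrBr mulr1 fp subr0.
have oneBg : 1 - (p + (1 - p) * f) = (1 - p) * (1 - f).
  by rewrite mulrBr mulr1 opprD addrA.
exists (p + (1 - p) * f); split.
- have fg : f * (p + (1 - p) * f) = f by rewrite mulrDr fp add0r mulrA fp1 ff.
  rewrite mulrDl -[_ * f * _]mulrA fg; congr (_ + _).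
  by rewrite mulrDr pp mulrA mulrBr mulr1 pp subrr mul0r addr0.
(* Expand [(1 - p) * f = (1 - p) * r * e ord0 * (1 - p)] with [p] the combination given by [c]. *)
- exists (fun k => if unlift ord0 k is Some j then c j - (1 - p) * r * e ord0 * c j
                   else (1 - p) * r).
  rewrite big_ord_recl unlift_none.
  under eq_bigr => j _ do rewrite liftK mulrBl -[_ * c j * _]mulrA.
  by rewrite sumrB -mulr_sumr -pE frE !mulrA mulrBr mulr1 addrCA.
- move=> k; rewrite -[X in I (X - _)]mulr1 -mulrBr oneBg mulrA.
  case: (unliftP ord0 k) => [j|] ->.
    by apply: (idealMr idealI); rewrite mulrBr mulr1.
  by rewrite mulrBr mulr1.
Qed.

(** Assuming exchange elements instead of the DM property lets the lemma apply to [R^c] as well. *)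
Lemma regular_mod_supplemented :
  (forall a, I a -> exchange_elt a) -> (forall a, regular_mod I a) ->
  finitely_supplemented I R^o.
Proof.
move=> exchI regR X [n [e XE]].
have [p [pp [c pE] Ip]] := regular_mod_range e regR.
have gg := idem_compl pp.
have Xp : (X : set R^o) p by rewrite XE; exists c.
pose Y := cyclic_submodule (1 - p : R^o).
have projY : projective_submodule Y by exact: projective_cyclic_idem.
have YE x : (Y : set R^o) x <-> x * (1 - p) = x by exact: cyclic_idemP.
clearbody Y.
have YP x : (Y : set R^o) x -> x * (1 - p) = x by move=> /YE.
have XYI x : (X `&` Y) x -> I x.
  rewrite XE => -[[b _ <-] /YP <-]; rewrite mulr_suml; apply: (ideal_sum idealI) => k.
  change (I (b k * e k * (1 - p))); rewrite -mulrA mulrBr mulr1.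
  exact: idealMl.
exists Y; split.
- exact: projY.
- apply: eq_regular_set => x; split=> // _.
  exists (x * p); first exact: submodule_mulr.
  exists (x * (1 - p)); first by apply/YE; rewrite -mulrA gg.
  by rewrite -mulrDr subrKC mulr1.
- move=> x XYx; rewrite -(YP _ XYx.2).
  by apply: sub_ideal_mul; [exact: XYI | exact/YE].
- move=> Z ZY NZ.
  (* The part [m] of the generator [1 - p] lies in [I]; its exchange idempotent [f] generates the
     required summand. *)
  have [m Nm [z Zz mz]] : add_set (X `&` Y) Z (1 - p) by rewrite NZ; exact/YE.
  have [f [r [s [ff rm sm]]]] := exchI _ (XYI _ Nm).
  have Nf : (X `&` Y) f.
    by rewrite -rm; case: Nm => Xm Ym; split; exact: (submodule_scale r).
  have SN : cyclic_submodule (f : R^o) `<=` X `&` Y.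
    by move=> _ [b _ <-]; case: Nf => Xf Yf; split; exact: submodule_scale.
  have Tclosed : submod_closed (mem [set x : R^o | (Y : set R^o) x /\ x * f = 0]).
    split; first by rewrite inE /= mul0r; split=> //; exact: submodule0.
    move=> b x y; rewrite !inE /= => -[Yx xf] [Yy yf]; split.
      by apply: submodule_add => //; exact: submodule_scale.
    by rewrite mulrDl yf addr0; change (b * x * f = 0); rewrite -mulrA xf mulr0.
  exists (cyclic_submodule (f : R^o)); split=> //.
  + exists (Submodule Tclosed); split.
      apply: eq_regular_set => x; split=> [[u /SN[_ Yu] [v [Yv _] <-]]|Yx].
        exact: submodule_add.
      exists (x * f); first by exists x.
      exists (x - x * f); last by rewrite subrKC.
      split; last by rewrite mulrBl -mulrA ff subrr.
      by apply: submodule_sub => //; exact: (submodule_mulr x Nf.2).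
    apply: eq_regular_set => x; split=> [[/cyclic_idemP xf [_ xf0]]|->].
      by rewrite /= -(xf ff).
    split; first by apply/cyclic_idemP; rewrite ?mul0r.
    by split; [exact: submodule0 | rewrite mul0r].
  + apply: eq_regular_set => x; split=> [[u /SN[_ Yu] [v /ZY Yv <-]]|Yx].
      exact: submodule_add.
    exists (x * f); first by exists x.
    exists (x * s * z); first exact: (submodule_mulr (x * s) Zz).
    (* Then [s * z = (1 - f) * (1 - p) = 1 - p - f], so [x * f + x * s * z = x]. *)
    have -> : z = (1 - m) * (1 - p) :> R.
      by rewrite mulrBl mul1r (YP _ Nm.2) -mz addrC addKr.
    rewrite -mulrA [s * _]mulrA sm mulrBl mul1r (YP _ Nf.2) mulrBr (YP _ Yx).
    by rewrite subrKC.
Qed.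
End Equivalences.

(** * The regular module as a free module, and the equivalences *)

Lemma fg_free_regular (R : pzRingType) : fg_free R^o.
Proof.
pose f (v : 'rV[R]_1) : R^o := v 0 0.
have flin : linear f by move=> c u v; rewrite /f !mxE.
pose fL : {linear 'rV[R]_1 -> R^o} := HB.pack f (GRing.isLinear.Build _ _ _ _ f flin).
exists 1%N, fL; exists (fun x : R => const_mx x) => [v|x]; last by rewrite /= /f mxE.
by apply/matrixP => i j; rewrite mxE !ord1.
Qed.

Theorem theorem5p7 (R : pzRingType) (I : set R)
    (idealI : two_sided_ideal I) (DMR : left_DM_ring I) :
  [<-> semiregular_ring I;
       finitely_supplemented I R^o;
       finitely_supplemented (I : set R^c) (R^c)^o].
Proof.
have exchI a : I a -> exchange_elt a.
  by apply: DM_exchange_elt => //; exact/DMR/fg_free_regular.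
have idealIc := two_sided_ideal_conv idealI.
tfae.
- move=> regR; apply: regular_mod_supplemented => // a.
  exact/semiregular_eltP/regR.
- move=> suppR; apply: (regular_mod_supplemented idealIc) => a.
    by move=> /exchI /exchange_elt_conv.
  exact/regular_mod_conv/supplemented_regular_mod.
- move=> suppR a; apply/(semiregular_eltP idealI).
  (* The opposite of [R^c] is [R] by conversion. *)
  exact: (regular_mod_conv (supplemented_regular_mod idealIc a suppR)).
Qed.
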